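(* There exist a functor $$\mathfrak{A}:\mathbf{A}_{\mathrm{fg}}\times\mathbf{A}^{\mathrm{op}}\to\mathbf{proA}_{\mathrm{fg}}$$ and a natural transformation $\mathfrak{h}$ assigning to every $B\in\mathbf{A}_{\mathrm{fg}}$ and $C\in\mathbf{A}$ a pro-morphism $$\mathfrak{h}(B,C):B\to C\otimes\mathfrak{A}(B,C)$$ (naturality meaning that $(\mathrm{id}_C\otimes\mathfrak{A}(g,f))\,\mathfrak{h}(B,C)=(f\otimes\mathrm{id})\,\mathfrak{h}(B',C')\,g$ for all algebra morphisms $g:B\to B'$ with $B,B'\in\mathbf{A}_{\mathrm{fg}}$ and $f:C'\to C$ in $\mathbf{A}$), with the following universal property: for every $B\in\mathbf{A}_{\mathrm{fg}}$, $C\in\mathbf{A}$, if $E\in\mathbf{proA}$ and $e:B\to C\otimes E$ is a pro-morphism, then there is a unique pro-morphism $\hat{e}:\mathfrak{A}(B,C)\to E$ satisfying $e=(\mathrm{id}_C\otimes\hat{e})\,\mathfrak{h}(B,C)$.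
   Context: Fix a field $\mathbb{K}$; algebras, linear maps and tensor products are over $\mathbb{K}$. $\mathbf{A}$ is the category of unital associative (not necessarily commutative) algebras with unit-preserving algebra morphisms, and $\mathbf{A}_{\mathrm{fg}}$ is its full subcategory of finitely generated algebras. For a category $\mathbf{C}$, $\mathbf{proC}$ is the category of pro-objects: an object is a contravariant functor from a directed set $\mathbf{I}$ to $\mathbf{C}$, i.e. a family $\{C_i\}_{i\in\mathbf{I}}$ with morphisms $C^{i'}_i:C_{i'}\to C_i$ for $i\le i'$ such that $C^i_i=\mathrm{id}$ and $C^{i''}_i=C^{i'}_iC^{i''}_{i'}$ for $i\le i'\le i''$; for pro-objects $C=\{C_i\}$ and $D=\{D_j\}$, the set of pro-morphisms is $\mathbf{proC}(C,D)=\varprojlim_j\varinjlim_i\mathbf{C}(C_i,D_j)$. Objects of $\mathbf{C}$ are regarded as pro-objects indexed by a one-element directed set. The category $\mathbf{proA}_{\mathrm{fg}}$ is the category of pro-objects of $\mathbf{A}_{\mathrm{fg}}$. For pro-algebras $A,B$ indexed by $\mathbf{I},\mathbf{J}$, the pro-algebra $A\otimes B$ is indexed by $\mathbf{I}\times\mathbf{J}$ with $(A\otimes B)_{(i,j)}=A_i\otimes B_j$ and $(A\otimes B)^{(i',j')}_{(i,j)}=A^{i'}_i\otimes B^{j'}_j$. Set-theoretic difficulties are disregarded by working in a fixed universe. *)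

(* Defs.v *)
From HB Require Import structures.
From mathcomp Require Import all_boot all_algebra.
From mathcomp Require Import generic_quotient.
From mathcomp Require Import boolp.

Set Implicit Arguments.
Unset Strict Implicit.
Unset Printing Implicit Defensive.

Import GRing.Theory.
Local Open Scope ring_scope.
Local Open Scope quotient_scope.

(* The library's algType requires 1 != 0, whereas the zero algebra is a unital
   algebra; the missing join of lmodType and pzRingType cannot be added to the
   library's hierarchy, hence a separate multiplication here. Morphisms are the
   linear maps preserving umul and uone. *)

HB.mixin Record Lmodule_isUalgebra (K : fieldType) A of GRing.Lmodule K A := {
  uone : A;
  umul : A -> A -> A;
  umulA : associative umul;
  umul1r : left_id uone umul;
  umulr1 : right_id uone umul;
  umulDl : left_distributive umul +%R;
  umulDr : right_distributive umul +%R;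
  umulZl : forall (k : K) (x y : A), umul (k *: x) y = k *: umul x y;
  umulZr : forall (k : K) (x y : A), umul x (k *: y) = k *: umul x y
}.

#[short(type="ualgType")]
HB.structure Definition Ualgebra (K : fieldType) :=
  {A of GRing.Lmodule K A & Lmodule_isUalgebra K A}.

HB.mixin Record isUmultiplicative (K : fieldType) (A B : ualgType K)
    (f : A -> B) := {
  umorph1 : f uone = uone;
  umorphM : {morph f : x y / umul x y}
}.

HB.structure Definition UalgMorphism (K : fieldType) (A B : ualgType K) :=
  {f of isUmultiplicative K A B f & @GRing.Linear K A B *:%R f}.

Notation "{ 'ualgmorphism' A -> B }" := (@UalgMorphism.type _ A B)
  (A at level 98, B at level 99,
   format "{ 'ualgmorphism'  A  ->  B }") : type_scope.

Lemma umul0l (K : fieldType) (A : ualgType K) : left_zero (0 : A) umul.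
Proof. by move=> x; rewrite -[0 in LHS](scale0r 0) umulZl scale0r. Qed.

Lemma umul0r (K : fieldType) (A : ualgType K) : right_zero (0 : A) umul.
Proof. by move=> x; rewrite -[0 in LHS](scale0r 0) umulZr scale0r. Qed.

Section UalgMorphismTheory.
Variables (K : fieldType) (A B C : ualgType K).

Lemma ualgmorphismP (f g : {ualgmorphism A -> B}) : f =1 g -> f = g.
Proof.
case: f g => [f [[f1 f2] [f3] [f4]]] [g [[g1 g2] [g3] [g4]]] /= /funext fg.
case: _ / fg in g1 g2 g3 g4 *.
by rewrite (Prop_irrelevance g1 f1) (Prop_irrelevance g2 f2)
  (Prop_irrelevance g3 f3) (Prop_irrelevance g4 f4).
Qed.

Fact id_umorph1 : @idfun A uone = uone. Proof. by []. Qed.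
Fact id_umorphM : {morph @idfun A : x y / umul x y}. Proof. by []. Qed.

HB.instance Definition _ :=
  isUmultiplicative.Build K A A idfun id_umorph1 id_umorphM.

Variables (g : {ualgmorphism B -> C}) (f : {ualgmorphism A -> B}).

Fact comp_umorph1 : (g \o f) uone = uone.
Proof. by rewrite /= !umorph1. Qed.
Fact comp_umorphM : {morph (g \o f) : x y / umul x y}.
Proof. by move=> x y; rewrite /= !umorphM. Qed.

HB.instance Definition _ :=
  isUmultiplicative.Build K A C (g \o f) comp_umorph1 comp_umorphM.

End UalgMorphismTheory.

Definition finitely_generated (K : fieldType) (A : ualgType K) : Prop :=
  exists s : seq A, forall S : A -> Prop,
    (forall x, x \in s -> S x) ->
    S uone ->
    (forall x y, S x -> S y -> S (x + y)) ->
    (forall x y, S x -> S y -> S (umul x y)) ->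
    (forall (k : K) x, S x -> S (k *: x)) ->
    forall x, S x.

(* A (x) B is the quotient of the free commutative monoid on A * B by the
   congruence below: a sequence of pairs (a, b) stands for the formal sum of
   the pure tensors a (x) b. *)
Section Tensor.
Variables (K : fieldType) (A B : lmodType K).

Inductive tensor_rel : seq (A * B) -> seq (A * B) -> Prop :=
| tensor_refl s : tensor_rel s s
| tensor_sym s t : tensor_rel s t -> tensor_rel t s
| tensor_trans t s u : tensor_rel s t -> tensor_rel t u -> tensor_rel s u
| tensor_cat s s' t t' :
    tensor_rel s s' -> tensor_rel t t' -> tensor_rel (s ++ t) (s' ++ t')
| tensor_catC s t : tensor_rel (s ++ t) (t ++ s)
| tensor_0l b : tensor_rel [:: (0, b)] [::]
| tensor_Dl a a' b : tensor_rel [:: (a + a', b)] [:: (a, b); (a', b)]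
| tensor_Dr a b b' : tensor_rel [:: (a, b + b')] [:: (a, b); (a, b')]
| tensor_Z k a b : tensor_rel [:: (k *: a, b)] [:: (a, k *: b)].

Definition tensor_relb : rel (seq (A * B)) := fun s t => `[< tensor_rel s t >].

Fact tensor_relb_refl : reflexive tensor_relb.
Proof. by move=> s; apply/asboolP; exact: tensor_refl. Qed.
Fact tensor_relb_sym : symmetric tensor_relb.
Proof.
by move=> s t; apply/asboolP/asboolP => st; exact: tensor_sym.
Qed.
Fact tensor_relb_trans : transitive tensor_relb.
Proof.
move=> t s u /asboolP st /asboolP tu; apply/asboolP; exact: tensor_trans tu.
Qed.

Canonical tensor_equiv :=
  EquivRel tensor_relb tensor_relb_refl tensor_relb_sym tensor_relb_trans.

Definition tensor := {eq_quot tensor_equiv}.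
HB.instance Definition _ := EqQuotient.on tensor.
HB.instance Definition _ := Choice.on tensor.

Lemma tensorP s t : \pi_tensor s = \pi_tensor t <-> tensor_rel s t.
Proof.
by split=> [/eqmodP /asboolP //|st]; apply/eqmodP; exact/asboolP.
Qed.

Definition ptens (a : A) (b : B) : tensor := \pi_tensor [:: (a, b)].

Definition tensor_add (x y : tensor) : tensor := \pi_tensor (repr x ++ repr y).
Definition tensor_scale (k : K) (x : tensor) : tensor :=
  \pi_tensor [seq (k *: p.1, p.2) | p <- repr x].

Lemma tensor_addE s t :
  tensor_add (\pi_tensor s) (\pi_tensor t) = \pi_tensor (s ++ t).
Proof. by apply/tensorP/tensor_cat; apply/tensorP; rewrite reprK. Qed.

Lemma tensor_scale_rel k s t : tensor_rel s t ->
  tensor_rel [seq (k *: p.1, p.2) | p <- s] [seq (k *: p.1, p.2) | p <- t].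
Proof.
elim=> {s t} /=.
- by move=> s; exact: tensor_refl.
- by move=> s t _; exact: tensor_sym.
- by move=> t s u _ st _; exact: tensor_trans.
- by move=> s s' t t' _ ss' _ tt'; rewrite !map_cat; exact: tensor_cat.
- by move=> s t; rewrite !map_cat; exact: tensor_catC.
- by move=> b; rewrite scaler0; exact: tensor_0l.
- by move=> a a' b; rewrite scalerDr; exact: tensor_Dl.
- by move=> a b b'; exact: tensor_Dr.
- by move=> l a b; rewrite scalerA mulrC -scalerA; exact: tensor_Z.
Qed.

Lemma tensor_scaleE k s :
  tensor_scale k (\pi_tensor s) = \pi_tensor [seq (k *: p.1, p.2) | p <- s].
Proof. by apply/tensorP/tensor_scale_rel; apply/tensorP; rewrite reprK. Qed.

Lemma tensor_seq_ind (P : tensor -> Prop) :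
  (forall s, P (\pi_tensor s)) -> forall x, P x.
Proof. by move=> Ps x; rewrite -[x]reprK. Qed.

Fact tensor_addA : associative tensor_add.
Proof.
elim/tensor_seq_ind => s; elim/tensor_seq_ind => t; elim/tensor_seq_ind => u.
by rewrite !tensor_addE catA.
Qed.

Fact tensor_addC : commutative tensor_add.
Proof.
elim/tensor_seq_ind => s; elim/tensor_seq_ind => t.
by rewrite !tensor_addE; apply/tensorP; exact: tensor_catC.
Qed.

Fact tensor_add0 : left_id (\pi_tensor [::]) tensor_add.
Proof. by elim/tensor_seq_ind => s; rewrite tensor_addE. Qed.

Let tcons a b s :
  \pi_tensor ((a, b) :: s) = tensor_add (ptens a b) (\pi_tensor s).
Proof. by rewrite tensor_addE. Qed.

Let tensor_addACA : interchange tensor_add tensor_add.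
Proof.
move=> x y z t; rewrite -!tensor_addA; congr tensor_add.
by rewrite !tensor_addA (tensor_addC y).
Qed.

Let tensor_scaleDr k : {morph tensor_scale k : x y / tensor_add x y}.
Proof.
elim/tensor_seq_ind => s; elim/tensor_seq_ind => t.
by rewrite !(tensor_addE, tensor_scaleE) map_cat.
Qed.

Let tensor_scaleDl x :
  {morph tensor_scale^~ x : k l / k + l >-> tensor_add k l}.
Proof.
move=> k l; elim/tensor_seq_ind: x => s; rewrite !tensor_scaleE.
elim: s => [|[a b] s /= IHs]; first by rewrite /= tensor_add0.
rewrite !tcons IHs tensor_addACA; congr tensor_add.
by rewrite scalerDl tensor_addE; apply/tensorP; exact: tensor_Dl.
Qed.

Let tensor_scale0 x : tensor_scale 0 x = \pi_tensor [::].
Proof.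
elim/tensor_seq_ind: x => s; rewrite tensor_scaleE.
elim: s => [//|[a b] s /= IHs]; rewrite tcons IHs scale0r.
rewrite tensor_addC tensor_add0; apply/tensorP; exact: tensor_0l.
Qed.

Let tensor_scale1 : left_id 1 tensor_scale.
Proof.
elim/tensor_seq_ind => s; rewrite tensor_scaleE; congr (\pi_tensor _).
by rewrite -[RHS]map_id; apply: eq_map => -[a b] /=; rewrite scale1r.
Qed.

Let tensor_scaleA k l x :
  tensor_scale k (tensor_scale l x) = tensor_scale (k * l) x.
Proof.
elim/tensor_seq_ind: x => s; rewrite !tensor_scaleE; congr (\pi_tensor _).
by rewrite -map_comp; apply: eq_map => -[a b] /=; rewrite scalerA.
Qed.

Fact tensor_addN :
  left_inverse (\pi_tensor [::]) (tensor_scale (- 1)) tensor_add.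
Proof.
move=> x; rewrite -[in X in tensor_add _ X](tensor_scale1 x).
by rewrite -tensor_scaleDl addNr tensor_scale0.
Qed.

HB.instance Definition _ :=
  GRing.isZmodule.Build tensor tensor_addA tensor_addC tensor_add0 tensor_addN.

HB.instance Definition _ := GRing.Zmodule_isLmodule.Build K tensor
  tensor_scaleA tensor_scale1 tensor_scaleDr tensor_scaleDl.

Lemma pi_tensor s : \pi_tensor s = \sum_(p <- s) ptens p.1 p.2.
Proof.
elim: s => [|[a b] s IHs]; first by rewrite big_nil.
by rewrite big_cons tcons IHs.
Qed.

Lemma ptensDl b : {morph ptens^~ b : a a' / a + a'}.
Proof.
by move=> a a'; rewrite [RHS]tensor_addE; apply/tensorP; exact: tensor_Dl.
Qed.

Lemma ptensDr a : {morph ptens a : b b' / b + b'}.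
Proof.
by move=> b b'; rewrite [RHS]tensor_addE; apply/tensorP; exact: tensor_Dr.
Qed.

Lemma ptensZl k a b : ptens (k *: a) b = k *: ptens a b.
Proof. by rewrite [RHS]tensor_scaleE. Qed.

Lemma ptensZr k a b : ptens a (k *: b) = k *: ptens a b.
Proof. by rewrite -ptensZl; apply/tensorP/tensor_sym; exact: tensor_Z. Qed.

Lemma tensor_ind (P : tensor -> Prop) :
    P 0 -> (forall a b x, P x -> P (ptens a b + x)) -> forall x, P x.
Proof.
move=> P0 PD; elim/tensor_seq_ind => s; rewrite pi_tensor.
by elim: s => [|p s IHs]; rewrite ?big_nil ?big_cons //; exact: PD.
Qed.

Definition bilinear_map (V : lmodType K) (f : A -> B -> V) : Prop :=
  [/\ forall b, {morph f^~ b : a a' / a + a'},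
      forall a, {morph f a : b b' / b + b'},
      forall k a b, f (k *: a) b = k *: f a b &
      forall k a b, f a (k *: b) = k *: f a b].

Definition tlift (V : lmodType K) (f : A -> B -> V) (x : tensor) : V :=
  \sum_(p <- repr x) f p.1 p.2.

Section Lift.
Variables (V : lmodType K) (f : A -> B -> V).
Hypothesis fP : bilinear_map f.

Lemma tlift_pi s : tlift f (\pi_tensor s) = \sum_(p <- s) f p.1 p.2.
Proof.
have [fDl fDr fZl fZr] := fP.
suff H t u : tensor_rel t u ->
    \sum_(p <- t) f p.1 p.2 = \sum_(p <- u) f p.1 p.2.
  by apply: H; apply/tensorP; rewrite reprK.
elim=> {t u} //.
- by move=> t s' u _ -> _ ->.
- by move=> t t' u u' _ IH _ IH'; rewrite !big_cat IH IH'.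
- by move=> t u; rewrite !big_cat /= addrC.
- by move=> b; rewrite big_seq1 big_nil /= -[0 in LHS](scale0r 0) fZl scale0r.
- by move=> a a' b; rewrite big_seq1 big_cons big_seq1 /= fDl.
- by move=> a b b'; rewrite big_seq1 big_cons big_seq1 /= fDr.
- by move=> k a b; rewrite !big_seq1 /= fZl fZr.
Qed.

Lemma tliftE a b : tlift f (ptens a b) = f a b.
Proof. by rewrite tlift_pi big_seq1. Qed.

Fact tlift_is_linear : linear (tlift f).
Proof.
have [_ _ fZl _] := fP.
move=> k; elim/tensor_seq_ind => s; elim/tensor_seq_ind => t.
rewrite [k *: _]tensor_scaleE [_ + _]tensor_addE !tlift_pi big_cat big_map /=.
by rewrite scaler_sumr; congr (_ + _); apply: eq_bigr => p _; rewrite /= fZl.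
Qed.

Lemma tliftD : {morph tlift f : x y / x + y}.
Proof.
by move=> x y; rewrite -[x]scale1r tlift_is_linear !scale1r.
Qed.

Lemma tliftZ k x : tlift f (k *: x) = k *: tlift f x.
Proof.
have t0 : tlift f 0 = 0 by apply: (addIr (tlift f 0)); rewrite -tliftD !add0r.
by rewrite -[k *: x]addr0 tlift_is_linear t0 addr0.
Qed.

Lemma tlift0 : tlift f 0 = 0.
Proof. by rewrite -[0 in LHS](scale0r 0) tliftZ scale0r. Qed.

End Lift.

End Tensor.

Section TensorAlgebra.
Variables (K : fieldType) (A B : ualgType K).
Implicit Types (x y z : tensor A B) (a : A) (b : B).

Definition tensor_mul x y : tensor A B :=
  tlift (fun a b => tlift (fun a' b' => ptens (umul a a') (umul b b')) y) x.

Let mul1P a b :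
  bilinear_map (fun (a' : A) (b' : B) => ptens (umul a a') (umul b b')).
Proof.
split=> [b' a' a''|a' b' b''|k a' b'|k a' b'] /=.
- by rewrite umulDr ptensDl.
- by rewrite umulDr ptensDr.
- by rewrite umulZr ptensZl.
- by rewrite umulZr ptensZr.
Qed.

Let mul2P y : bilinear_map (fun (a : A) (b : B) =>
  tlift (fun a' b' => ptens (umul a a') (umul b b')) y).
Proof.
split=> [b a a'|a b b'|k a b|k a b] /=;
  elim/tensor_ind: y => [|a1 b1 y IHy]; rewrite ?tlift0 ?addr0 ?scaler0 //;
  rewrite !tliftD // IHy !tliftE // ?umulDl ?umulZl.
- by rewrite ptensDl addrACA.
- by rewrite ptensDr addrACA.
- by rewrite ptensZl scalerDr.
- by rewrite ptensZr scalerDr.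
Qed.

Lemma tensor_mulE a b a' b' :
  tensor_mul (ptens a b) (ptens a' b') = ptens (umul a a') (umul b b').
Proof. by rewrite /tensor_mul !tliftE. Qed.

Fact tensor_mulDl : left_distributive tensor_mul +%R.
Proof. by move=> x y z; rewrite /tensor_mul tliftD. Qed.

Fact tensor_mulDr : right_distributive tensor_mul +%R.
Proof.
move=> x y z; rewrite /tensor_mul; elim/tensor_ind: x => [|a b x IHx].
  by rewrite !tlift0 // addr0.
by rewrite !tliftD // !tliftE // IHx tliftD // addrACA.
Qed.

Fact tensor_mulZl k x y : tensor_mul (k *: x) y = k *: tensor_mul x y.
Proof. by rewrite /tensor_mul tliftZ. Qed.

Fact tensor_mulZr k x y : tensor_mul x (k *: y) = k *: tensor_mul x y.
Proof.
rewrite /tensor_mul; elim/tensor_ind: x => [|a b x IHx].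
  by rewrite !tlift0 // scaler0.
by rewrite !tliftD // !tliftE // IHx tliftZ // scalerDr.
Qed.

Let mul0 x : tensor_mul 0 x = 0.
Proof. by rewrite -[0 in LHS](scale0r 0) tensor_mulZl scale0r. Qed.
Let mulx0 x : tensor_mul x 0 = 0.
Proof. by rewrite -[0 in LHS](scale0r 0) tensor_mulZr scale0r. Qed.

Fact tensor_mulA : associative tensor_mul.
Proof.
elim/tensor_ind => [|a b x IHx] y z; first by rewrite !mul0.
rewrite !tensor_mulDl IHx; congr (_ + _) => {x IHx}.
elim/tensor_ind: y => [|a' b' y IHy]; first by rewrite !(mul0, mulx0).
rewrite tensor_mulDl !tensor_mulDr tensor_mulDl IHy; congr (_ + _) => {y IHy}.
elim/tensor_ind: z => [|a'' b'' z IHz]; first by rewrite !mulx0.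
by rewrite !tensor_mulDr IHz !tensor_mulE !umulA.
Qed.

Fact tensor_mul1l : left_id (ptens uone uone) tensor_mul.
Proof.
elim/tensor_ind => [|a b x IHx]; first by rewrite mulx0.
by rewrite tensor_mulDr IHx tensor_mulE !umul1r.
Qed.

Fact tensor_mul1r : right_id (ptens uone uone) tensor_mul.
Proof.
elim/tensor_ind => [|a b x IHx]; first by rewrite mul0.
by rewrite tensor_mulDl IHx tensor_mulE !umulr1.
Qed.

HB.instance Definition _ := Lmodule_isUalgebra.Build K (tensor A B)
  tensor_mulA tensor_mul1l tensor_mul1r tensor_mulDl tensor_mulDr
  tensor_mulZl tensor_mulZr.

End TensorAlgebra.

Section TensorMap.
Variables (K : fieldType) (A A' B B' : ualgType K).
Variables (f : {ualgmorphism A -> A'}) (g : {ualgmorphism B -> B'}).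

Definition tensor_map : tensor A B -> tensor A' B' :=
  tlift (fun a b => ptens (f a) (g b)).

Let mapP : bilinear_map (fun (a : A) (b : B) => ptens (f a) (g b)).
Proof.
split=> [b a a'|a b b'|k a b|k a b] /=.
- by rewrite linearD ptensDl.
- by rewrite linearD ptensDr.
- by rewrite linearZ ptensZl.
- by rewrite linearZ ptensZr.
Qed.

Lemma tensor_mapE a b : tensor_map (ptens a b) = ptens (f a) (g b).
Proof. exact: tliftE. Qed.

Fact tensor_map_is_linear : linear tensor_map.
Proof. exact: tlift_is_linear. Qed.

HB.instance Definition _ :=
  GRing.isLinear.Build K (tensor A B) (tensor A' B') *:%R tensor_map
    tensor_map_is_linear.

Fact tensor_map1 : tensor_map uone = uone.
Proof. by rewrite [LHS]tensor_mapE !umorph1. Qed.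

Fact tensor_mapM : {morph tensor_map : x y / umul x y}.
Proof.
elim/tensor_ind => [|a b x IHx] y; first by rewrite !(umul0l, linear0).
rewrite umulDl !linearD /= umulDl IHx; congr (_ + _) => {x IHx}.
elim/tensor_ind: y => [|a' b' y IHy]; first by rewrite !(umul0r, linear0).
rewrite umulDr !linearD /= umulDr IHy; congr (_ + _).
by rewrite [umul _ _]tensor_mulE !tensor_mapE [RHS]tensor_mulE !umorphM.
Qed.

HB.instance Definition _ :=
  isUmultiplicative.Build K (tensor A B) (tensor A' B') tensor_map
    tensor_map1 tensor_mapM.

End TensorMap.

#[local] Obligation Tactic := idtac.

Record category := Category {
  ob :> Type;
  mor : ob -> ob -> Type;
  idm : forall a, mor a a;
  compm : forall x y z, mor y z -> mor x y -> mor x z;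
  comp1m : forall a b (f : mor a b), compm (idm b) f = f;
  compm1 : forall a b (f : mor a b), compm f (idm a) = f;
  compmA : forall a b c d (h : mor c d) (g : mor b c) (f : mor a b),
    compm h (compm g f) = compm (compm h g) f
}.
Arguments mor {C} a b : rename.
Arguments idm {C} a : rename.
Arguments compm {C x y z} g f : rename.
Notation "g \oc f" := (compm g f)
  (at level 50, left associativity, format "g  \oc  f").

Record functor (C D : category) := Functor {
  fob :> C -> D;
  fmap : forall a b, mor a b -> mor (fob a) (fob b);
  fmap1 : forall a, fmap (idm a) = idm (fob a);
  fmapM : forall a b c (g : mor b c) (f : mor a b),
    fmap (g \oc f) = fmap g \oc fmap f
}.
Arguments fmap {C D} F {a b} f : rename.

Section Constructions.
Variables C D E : category.

Program Definition op_cat : category :=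
  @Category C (fun a b => mor b a) idm (fun _ _ _ g f => f \oc g) _ _ _.
Next Obligation. by move=> a b f; exact: compm1. Qed.
Next Obligation. by move=> a b f; exact: comp1m. Qed.
Next Obligation. by move=> a b c d h g f; rewrite /= compmA. Qed.

Program Definition prod_cat : category :=
  @Category (C * D) (fun a b => (mor a.1 b.1 * mor a.2 b.2)%type)
    (fun a => (idm a.1, idm a.2))
    (fun _ _ _ g f => (g.1 \oc f.1, g.2 \oc f.2)) _ _ _.
Next Obligation. by move=> a b [f g]; rewrite !comp1m. Qed.
Next Obligation. by move=> a b [f g]; rewrite !compm1. Qed.
Next Obligation. by move=> a b c d h g f; rewrite /= !compmA. Qed.

Definition full_subcat (P : C -> Prop) : category :=
  @Category {a : C | P a} (fun a b => mor (sval a) (sval b))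
    (fun a => idm (sval a)) (fun _ _ _ g f => g \oc f)
    (fun _ _ => @comp1m C _ _) (fun _ _ => @compm1 C _ _)
    (fun _ _ _ _ => @compmA C _ _ _ _).

Definition subcat_incl (P : C -> Prop) : functor (full_subcat P) C :=
  @Functor (full_subcat P) C sval (fun _ _ f => f)
    (fun _ => erefl) (fun _ _ _ _ _ => erefl).

Program Definition comp_functor (G : functor D E) (F : functor C D) :
    functor C E :=
  @Functor C E (fun a => G (F a)) (fun _ _ f => fmap G (fmap F f)) _ _.
Next Obligation. by move=> G F a; rewrite /= !fmap1. Qed.
Next Obligation. by move=> G F a b c g f; rewrite /= !fmapM. Qed.

End Constructions.

Record directed_set := DirectedSet {
  dset :> Type;
  dle : dset -> dset -> Prop;
  dle_refl : forall i, dle i i;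
  dle_trans : forall i j k, dle i j -> dle j k -> dle i k;
  dset_inhabited : inhabited dset;
  dle_directed : forall i j, exists k, dle i k /\ dle j k
}.
Arguments dle {d} i j.

Program Definition unit_dset : directed_set :=
  @DirectedSet unit (fun _ _ => True) (fun=> I) (fun _ _ _ _ _ => I)
    (inhabits tt) _.
Next Obligation. by move=> i j; exists tt. Qed.

Program Definition prod_dset (I J : directed_set) : directed_set :=
  @DirectedSet (I * J) (fun p q => dle p.1 q.1 /\ dle p.2 q.2) _ _ _ _.
Next Obligation. by move=> I J [i j]; split; exact: dle_refl. Qed.
Next Obligation.
move=> I J p q r [pq1 pq2] [qr1 qr2].
by split; [exact: dle_trans pq1 qr1 | exact: dle_trans pq2 qr2].
Qed.
Next Obligation.
by move=> I J; have [i] := dset_inhabited I; have [j] := dset_inhabited J.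
Qed.
Next Obligation.
move=> I J p q; have [i [pi qi]] := dle_directed p.1 q.1.
by have [j [pj qj]] := dle_directed p.2 q.2; exists (i, j).
Qed.

Record pro_object (C : category) := ProObject {
  pidx : directed_set;
  pobj :> pidx -> C;
  ptr : forall i i', dle i i' -> mor (pobj i') (pobj i);
  ptr_id : forall i (h : dle i i), ptr h = idm (pobj i);
  ptr_comp : forall i i' i'' (h : dle i i') (h' : dle i' i'')
    (h'' : dle i i''), ptr h'' = ptr h \oc ptr h'
}.
Arguments ptr {C} X {i i'} h : rename.

(* germ X d is the filtered colimit over i of the sets mor (X i) d; pro_mor X Y
   below is the limit over j of the sets germ X (Y j). *)
Section Germ.
Variables (C : category) (X : pro_object C).

Section Quotient.
Variable d : C.

Definition pregerm : Type := {i : pidx X & mor (X i) d}.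

Definition germ_rel (u v : pregerm) : Prop :=
  exists k (hu : dle (tag u) k) (hv : dle (tag v) k),
    tagged u \oc ptr X hu = tagged v \oc ptr X hv.

Definition germ_relb : rel {classic pregerm} := fun u v => `[< germ_rel u v >].

Fact germ_relb_refl : reflexive germ_relb.
Proof.
by move=> u; apply/asboolP; exists (tag u), (dle_refl _), (dle_refl _).
Qed.

Fact germ_relb_sym : symmetric germ_relb.
Proof.
by move=> u v; apply/asboolP/asboolP => -[k [hu [hv e]]]; exists k, hv, hu.
Qed.

Fact germ_relb_trans : transitive germ_relb.
Proof.
move=> v u w /asboolP[k [hu [hv e]]] /asboolP[l [hv' [hw e']]].
apply/asboolP; have [m [km lm]] := dle_directed k l.
exists m, (dle_trans hu km), (dle_trans hw lm).
rewrite (ptr_comp hu km) (ptr_comp hw lm) !compmA e -e' -!compmA.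
by rewrite -(ptr_comp _ _ (dle_trans hv km)) -(ptr_comp _ _ (dle_trans hv km)).
Qed.

Canonical germ_equiv :=
  EquivRel germ_relb germ_relb_refl germ_relb_sym germ_relb_trans.

Definition germ := {eq_quot germ_equiv}.
HB.instance Definition _ := EqQuotient.on germ.

Definition mkgerm i (f : mor (X i) d) : germ :=
  \pi_germ (Tagged (fun i => mor (X i) d) f : {classic pregerm}).

Lemma mkgermP i i' (f : mor (X i) d) (f' : mor (X i') d) :
  mkgerm f = mkgerm f' <->
  exists k (h : dle i k) (h' : dle i' k), f \oc ptr X h = f' \oc ptr X h'.
Proof.
split=> [/eqmodP /asboolP //|e]; apply/eqmodP; exact/asboolP.
Qed.

Lemma mkgerm_ptr i i' (h : dle i i') (f : mor (X i) d) :
  mkgerm (f \oc ptr X h) = mkgerm f.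
Proof.
apply/mkgermP; exists i', (dle_refl _), h.
by rewrite ptr_id compm1.
Qed.

Lemma germ_ind (P : germ -> Prop) :
  (forall i (f : mor (X i) d), P (mkgerm f)) -> forall u, P u.
Proof. by move=> Pf u; rewrite -[u]reprK; case: (repr u). Qed.

Definition germ_idx (u : germ) : pidx X := tag (repr u).
Definition germ_map (u : germ) : mor (X (germ_idx u)) d := tagged (repr u).

Lemma germK (u : germ) : mkgerm (germ_map u) = u.
Proof. by rewrite -[RHS]reprK /mkgerm /germ_map /germ_idx; case: (repr u). Qed.

End Quotient.

Definition germ_post (d d' : C) (g : mor d d') (u : germ d) : germ d' :=
  mkgerm (g \oc germ_map u).

Lemma germ_postE (d d' : C) (g : mor d d') i (f : mor (X i) d) :
  germ_post g (mkgerm f) = mkgerm (g \oc f).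
Proof.
have /mkgermP[k [h [h' e]]] := germK (mkgerm f).
by apply/mkgermP; exists k, h, h'; rewrite -!compmA e.
Qed.

Lemma germ_post1 d (u : germ d) : germ_post (idm d) u = u.
Proof. by rewrite /germ_post comp1m germK. Qed.

Lemma germ_postM d d' d'' (g' : mor d' d'') (g : mor d d') (u : germ d) :
  germ_post g' (germ_post g u) = germ_post (g' \oc g) u.
Proof. by elim/germ_ind: u => i f; rewrite !germ_postE compmA. Qed.

End Germ.

Record pro_mor (C : category) (X Y : pro_object C) := ProMor {
  pgerm :> forall j : pidx Y, germ X (Y j);
  pgerm_compat : forall j j' (h : dle j j'),
    germ_post (ptr Y h) (pgerm j') = pgerm j
}.

Lemma pro_morP (C : category) (X Y : pro_object C) (phi psi : pro_mor X Y) :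
  (forall j, phi j = psi j) -> phi = psi.
Proof.
case: phi psi => [p hp] [q hq] /= pq.
have {}pq : p = q by exact: functional_extensionality_dep.
by case: _ / pq in hq *; rewrite (Prop_irrelevance hp hq).
Qed.

Section ProCategory.
Variable C : category.
Implicit Types X Y Z : pro_object C.

Program Definition pro_id X : pro_mor X X :=
  @ProMor C X X (fun i => mkgerm (idm (X i))) _.
Next Obligation.
move=> X i j h.
by rewrite germ_postE compm1 -[ptr _ _]comp1m mkgerm_ptr.
Qed.

Definition germ_pre X Y (phi : pro_mor X Y) d (u : germ Y d) : germ X d :=
  germ_post (germ_map u) (phi (germ_idx u)).

Lemma germ_preE X Y (phi : pro_mor X Y) d j (g : mor (Y j) d) :
  germ_pre phi (mkgerm g) = germ_post g (phi j).
Proof.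
have /mkgermP[k [h [h' e]]] := germK (mkgerm g).
rewrite /germ_pre -(pgerm_compat phi h) germ_postM e.
by rewrite -germ_postM pgerm_compat.
Qed.

Lemma germ_pre_post X Y (phi : pro_mor X Y) d d' (g : mor d d') (u : germ Y d) :
  germ_pre phi (germ_post g u) = germ_post g (germ_pre phi u).
Proof.
by elim/germ_ind: u => j f; rewrite germ_postE !germ_preE germ_postM.
Qed.

Program Definition pro_comp X Y Z (psi : pro_mor Y Z) (phi : pro_mor X Y) :
  pro_mor X Z := @ProMor C X Z (fun k => germ_pre phi (psi k)) _.
Next Obligation.
by move=> X Y Z psi phi j j' h; rewrite -germ_pre_post pgerm_compat.
Qed.

Program Definition pro_cat : category :=
  @Category (pro_object C) (@pro_mor C) pro_id pro_comp _ _ _.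
Next Obligation.
by move=> X Y phi; apply: pro_morP => j /=; rewrite germ_preE germ_post1.
Qed.
Next Obligation.
move=> X Y phi; apply: pro_morP => j /=; elim/germ_ind: (phi j) => i g.
by rewrite germ_preE /= germ_postE compm1.
Qed.
Next Obligation.
move=> X Y Z T h g f; apply: pro_morP => j /=; elim/germ_ind: (h j) => i k.
by rewrite germ_preE /= -germ_pre_post; congr germ_pre; rewrite germ_preE.
Qed.

Program Definition pro_const_ob (a : C) : pro_object C :=
  @ProObject C unit_dset (fun=> a) (fun _ _ _ => idm a) _ _.
Next Obligation. by []. Qed.
Next Obligation. by move=> *; rewrite comp1m. Qed.

Program Definition pro_const_mor (a b : C) (f : mor a b) :
  pro_mor (pro_const_ob a) (pro_const_ob b) :=
  @ProMor C (pro_const_ob a) (pro_const_ob b)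
    (fun=> @mkgerm C (pro_const_ob a) b tt f) _.
Next Obligation. by move=> *; rewrite germ_postE comp1m. Qed.

Program Definition pro_const : functor C pro_cat :=
  @Functor C pro_cat pro_const_ob pro_const_mor _ _.
Next Obligation. by move=> a; apply: pro_morP => -[]. Qed.
Next Obligation.
by move=> a b c g f; apply: pro_morP => j /=; rewrite germ_preE /= germ_postE.
Qed.

End ProCategory.

Section ProFunctor.
Variables (C D : category) (F : functor C D).

Program Definition pro_map_ob (X : pro_object C) : pro_object D :=
  @ProObject D (pidx X) (fun i => F (X i)) (fun _ _ h => fmap F (ptr X h)) _ _.
Next Obligation. by move=> X i h; rewrite /= ptr_id fmap1. Qed.
Next Obligation.
by move=> X i i' i'' h h' h''; rewrite /= (ptr_comp h h') fmapM.
Qed.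

Definition germ_fmap (X : pro_object C) d (u : germ X d) :
  germ (pro_map_ob X) (F d) :=
  @mkgerm D (pro_map_ob X) (F d) (germ_idx u) (fmap F (germ_map u)).

Lemma germ_fmapE (X : pro_object C) d i (f : mor (X i) d) :
  germ_fmap (mkgerm f) = @mkgerm D (pro_map_ob X) (F d) i (fmap F f).
Proof.
have /mkgermP[k [h [h' e]]] := germK (mkgerm f).
by apply/mkgermP; exists k, h, h'; rewrite /= -!fmapM e.
Qed.

Program Definition pro_map_mor (X Y : pro_object C) (phi : pro_mor X Y) :
  pro_mor (pro_map_ob X) (pro_map_ob Y) :=
  @ProMor D (pro_map_ob X) (pro_map_ob Y) (fun j => germ_fmap (phi j)) _.
Next Obligation.
move=> X Y phi j j' h; rewrite /= -(pgerm_compat phi h).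
elim/germ_ind: (phi j') => i f.
by rewrite germ_postE !germ_fmapE germ_postE fmapM.
Qed.

Program Definition pro_functor : functor (pro_cat C) (pro_cat D) :=
  @Functor (pro_cat C) (pro_cat D) pro_map_ob pro_map_mor _ _.
Next Obligation.
by move=> X; apply: pro_morP => i /=; rewrite germ_fmapE fmap1.
Qed.
Next Obligation.
move=> X Y Z psi phi; apply: pro_morP => k /=.
elim/germ_ind: (psi k) => j g; rewrite germ_fmapE !germ_preE /=.
elim/germ_ind: (phi j) => i f.
by rewrite germ_postE !germ_fmapE germ_postE fmapM.
Qed.

End ProFunctor.

Section ProProduct.
Variables C D : category.

Program Definition pro_prod_ob (X : pro_object C) (Y : pro_object D) :
  pro_object (prod_cat C D) :=
  @ProObject (prod_cat C D) (prod_dset (pidx X) (pidx Y))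
    (fun p => (X p.1, Y p.2)) (fun _ _ h => (ptr X h.1, ptr Y h.2)) _ _.
Next Obligation. by move=> X Y [i j] [h h'] /=; rewrite !ptr_id. Qed.
Next Obligation.
move=> X Y p q r h h' h'' /=.
by rewrite (ptr_comp h.1 h'.1) (ptr_comp h.2 h'.2).
Qed.

Definition germ_pair (X : pro_object C) (Y : pro_object D) c d
    (u : germ X c) (v : germ Y d) : germ (pro_prod_ob X Y) (c, d) :=
  @mkgerm (prod_cat C D) (pro_prod_ob X Y) (c, d)
    (germ_idx u, germ_idx v) (germ_map u, germ_map v).

Lemma germ_pairE (X : pro_object C) (Y : pro_object D) c d
    i (f : mor (X i) c) j (g : mor (Y j) d) :
  germ_pair (mkgerm f) (mkgerm g) =
  @mkgerm (prod_cat C D) (pro_prod_ob X Y) (c, d) (i, j) (f, g).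
Proof.
have /mkgermP[k [h [h' e]]] := germK (mkgerm f).
have /mkgermP[l [m [m' e']]] := germK (mkgerm g).
apply/mkgermP; exists (k, l), (conj h m), (conj h' m').
have proj1E (P Q : Prop) (x : P) (y : Q) : proj1 (conj x y) = x by [].
have proj2E (P Q : Prop) (x : P) (y : Q) : proj2 (conj x y) = y by [].
by rewrite /= !proj1E !proj2E e e'.
Qed.

Program Definition pro_prod_mor (X X' : pro_object C) (Y Y' : pro_object D)
    (phi : pro_mor X X') (psi : pro_mor Y Y') :
  pro_mor (pro_prod_ob X Y) (pro_prod_ob X' Y') :=
  @ProMor (prod_cat C D) (pro_prod_ob X Y) (pro_prod_ob X' Y')
    (fun p => germ_pair (phi p.1) (psi p.2)) _.
Next Obligation.
move=> X X' Y Y' phi psi p q h.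
rewrite /= -(pgerm_compat phi h.1) -(pgerm_compat psi h.2).
elim/germ_ind: (phi q.1) => i f; elim/germ_ind: (psi q.2) => j g.
by rewrite germ_pairE !germ_postE germ_pairE.
Qed.

Program Definition pro_prod :
  functor (prod_cat (pro_cat C) (pro_cat D)) (pro_cat (prod_cat C D)) :=
  @Functor (prod_cat (pro_cat C) (pro_cat D)) (pro_cat (prod_cat C D))
    (fun P => pro_prod_ob P.1 P.2) (fun _ _ f => pro_prod_mor f.1 f.2) _ _.
Next Obligation.
by move=> [X Y]; apply: pro_morP => -[i j] /=; rewrite germ_pairE.
Qed.
Next Obligation.
move=> [X Y] [X' Y'] [X'' Y''] [psi psi'] [phi phi'].
apply: pro_morP => -[k k'] /=.
elim/germ_ind: (psi k) => j g; elim/germ_ind: (psi' k') => j' g'.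
rewrite (germ_preE phi g) (germ_preE phi' g').
rewrite [germ_pair (mkgerm g) _]germ_pairE germ_preE /=.
elim/germ_ind: (phi j) => i f; elim/germ_ind: (phi' j') => i' f'.
rewrite (germ_postE g f) (germ_postE g' f').
by rewrite [germ_pair (mkgerm f) _]germ_pairE germ_postE; exact: germ_pairE.
Qed.

End ProProduct.

Section AlgebraCategories.
Variable K : fieldType.

Program Definition alg_cat : category :=
  @Category (ualgType K) (fun A B => {ualgmorphism A -> B})
    (fun A => idfun) (fun _ _ _ g f => g \o f) _ _ _.
Next Obligation. by move=> A B f; exact: ualgmorphismP. Qed.
Next Obligation. by move=> A B f; exact: ualgmorphismP. Qed.
Next Obligation. by move=> A B C D h g f; exact: ualgmorphismP. Qed.

Definition fgalg_cat : category :=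
  full_subcat (C := alg_cat) (@finitely_generated K).

Definition fgalg_incl : functor fgalg_cat alg_cat := subcat_incl _.

Program Definition tensor_functor :
  functor (prod_cat alg_cat alg_cat) alg_cat :=
  @Functor (prod_cat alg_cat alg_cat) alg_cat
    (fun P => (tensor P.1 P.2 : ualgType K))
    (fun _ _ f => (tensor_map f.1 f.2 : {ualgmorphism _ -> _})) _ _.
Next Obligation.
move=> [A B]; apply: ualgmorphismP => x /=.
elim/tensor_ind: x => [|a b x IHx]; first by rewrite linear0.
by rewrite linearD /= IHx tensor_mapE.
Qed.
Next Obligation.
move=> [A B] [A' B'] [A'' B''] [g g'] [f f']; apply: ualgmorphismP => x /=.
elim/tensor_ind: x => [|a b x IHx]; first by rewrite !linear0.
by rewrite !linearD /= IHx !tensor_mapE.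
Qed.

(* By computation, the pro-algebra X (x) Y is indexed by pairs (i, j), with
   (X (x) Y)_(i, j) = X_i (x) Y_j. *)
Definition pro_tensor :
  functor (prod_cat (pro_cat alg_cat) (pro_cat alg_cat)) (pro_cat alg_cat) :=
  comp_functor (pro_functor tensor_functor) (pro_prod alg_cat alg_cat).

Definition pro_tensor_ob (X Y : pro_cat alg_cat) : pro_cat alg_cat :=
  pro_tensor (X, Y).

Definition pro_tensor_mor (X X' Y Y' : pro_cat alg_cat)
    (f : mor X X') (g : mor Y Y') :
    mor (pro_tensor_ob X Y) (pro_tensor_ob X' Y') :=
  fmap pro_tensor (a := (X, Y)) (b := (X', Y')) (f, g).

Definition algP : functor alg_cat (pro_cat alg_cat) := pro_const alg_cat.
Definition fgalgP : functor fgalg_cat (pro_cat alg_cat) :=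
  comp_functor algP fgalg_incl.

Definition profg_incl : functor (pro_cat fgalg_cat) (pro_cat alg_cat) :=
  pro_functor fgalg_incl.

End AlgebraCategories.

Arguments algP {K}.
Arguments fgalgP {K}.
Arguments profg_incl {K}.

Notation "X \ox Y" := (pro_tensor_ob X Y)
  (at level 40, left associativity, format "X  \ox  Y").
Notation "f \oxm g" := (pro_tensor_mor f g)
  (at level 40, left associativity, format "f  \oxm  g").

(* Main.v *)
Require Import Defs.
From HB Require Import structures.
From mathcomp Require Import all_boot all_algebra generic_quotient.
From mathcomp Require Import boolp classical_sets.

(** Fix B, generated by a finite sequence s, and an algebra C.  A morphism
e : B -> C (x) E is determined by its coefficients (lam (x) id) (e b) in E,
where b ranges over B and lam over the linear functionals of C, because these
functionals separate the points of C (x) E ([tcontract_inj]).  So the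
representing object should be generated by symbols (b, lam), subject to
whatever relations hold between the coefficients of every e.  With all e
allowed this algebra need not receive a map from B, since the expected value
sum_k c_k (x) (b, lam_k) would run over a basis of C.  Hence the pro-object:
for a finite sequence i in C let A_i be the quotient of the formal expressions
in the symbols (b, lam) by the relations valid in E for every e that maps the
generators s into span(i) (x) E.  Enlarging i admits more morphisms e, hence
fewer relations, so that A_j maps onto A_i when i is included in j, and this
map is the identity on expressions.

The relations are defined by what holds for all e, not by a presentation, so
the identities of an algebra hold in A_i because they hold in every E, and each
admissible e induces ev_e : A_i -> E by definition.  These maps ev_e are jointly
injective, and so are the maps id (x) ev_e on C (x) A_i ([tensor_cspec_inj]).
Consequently there is at most one element h_i b of C (x) A_i sent to e b by
id (x) ev_e for all admissible e, and uniqueness makes h_i a morphism as soon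
as h_i b exists.  Existence ([universal_element]) is clear for sums and products
once it is known on s; for b in s, choose finitely many c_k, lam_k such that
x = sum_k lam_k(x) c_k on span(i) ([finite_rank_fix]), and take
h_i b = sum_k c_k (x) (b, lam_k).  The same computation shows that the finitely
many (b, lam_k), with b in s, generate A_i.

A morphism e : B -> C (x) E is admissible for some i, because every tensor
involves finitely many elements of C; this gives the factorization
e = (id (x) ev_e) h_i.  It is unique up to enlarging i, because the symbol
(b, lam) is the coefficient (lam (x) id) (h_i b), so that g : A_i -> E is
determined by (id (x) g) h_i ([pro_calg_germ_eq]).  Applied to every term of a
pro-algebra E, this single uniqueness statement yields compatibility with the
transition maps of E and uniqueness of the pro-morphism.  Functoriality in
(B, C) is then forced by the universal property. *)

Set Implicit Arguments.
Unset Strict Implicit.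
Unset Printing Implicit Defensive.

Import GRing.Theory.
Local Open Scope ring_scope.
Local Open Scope quotient_scope.
#[local] Obligation Tactic := idtac.

(** * Linear functionals and finite-rank operators *)

(** The coordinate along y modulo A is unique because A avoids y, and uniqueness
makes it linear. *)
Lemma functional_of_hyperplane (K : fieldType) (V : lmodType K) (A : set V)
    (y : V) :
    (forall k x x', A x -> A x' -> A (k *: x + x')) ->
    ~ A y -> (forall x, exists k, A (x - k *: y)) ->
  exists lam : {scalar V}, lam y = 1.
Proof.
move=> AD Ay Asub; pose f x := sval (cid (Asub x)).
have fP x : A (x - f x *: y) by rewrite /f; case: cid.
have A0 : A 0.
  by rewrite -(addNr (y - f y *: y)) -[- (_ - _)]scaleN1r; exact: AD.
have AZ k x : A x -> A (k *: x) by move=> Ax; rewrite -[_ *: _]addr0; exact: AD.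
have AB x x' : A x -> A x' -> A (x' - x).
  by move=> Ax Ax'; rewrite addrC -scaleN1r; exact: AD.
have fE x k : A (x - k *: y) -> f x = k.
  move=> /(AB _ _ (fP x)); rewrite addrAC opprB addrC [x + _]addrC subrK.
  rewrite addrC -scalerBl => Ak.
  apply/eqP; apply: contra_notT Ay => fk; rewrite -subr_eq0 in fk.
  by have := AZ (f x - k)^-1 _ Ak; rewrite scalerA mulVf // scale1r.
have flin : scalar f.
  move=> k x x'; apply: fE => /=; have := AD k _ _ (fP x) (fP x').
  by rewrite scalerBr scalerA scalerDl opprD addrACA.
pose g : V -> K := f; pose lin := GRing.isLinear.Build K V K _ g flin.
pose lam : {scalar V} := HB.pack g lin; exists lam; apply: fE.
by rewrite scale1r subrr.
Qed.

(** A subspace maximal among those avoiding y is a complement of the line K y,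
since any larger subspace contains y. *)
Lemma functional_eq1 (K : fieldType) (V : lmodType K) (y : V) :
  y <> 0 -> exists lam : {scalar V}, lam y = 1.
Proof.
move=> y0; pose P (A : set V) := ~ A y /\
  forall k l x x', A x -> A x' -> A (k *: x + l *: x').
have [|A [[Ay AD] Amax]] := @Zorn_bigcup V P.
  move=> F FP Ftot; split=> [[A /FP[+ _]]//|k l x x' [A FA Ax] [A' FA' Ax']].
  have [AA'|A'A] := Ftot _ _ FA FA'.
    by exists A' => //; apply: (FP _ FA').2 => //; exact: AA'.
  by exists A => //; apply: (FP _ FA).2 => //; exact: A'A.
(* The conditions on A hold for the empty set, so that 0 has to be adjoined
   to a maximal A. *)
pose A0 := [set x | A x \/ x = 0]%classic.
have A0D k l x x' : A0 x -> A0 x' -> A0 (k *: x + l *: x').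
  move=> [Ax|->] [Ax'|->]; rewrite ?scaler0 ?addr0 ?add0r; try by right.
  - by left; exact: AD.
  - by left; rewrite -[k *: x]addr0 -(scale0r x); exact: AD.
  - by left; rewrite -[l *: x']add0r -(scale0r x'); exact: AD.
have A0y : ~ A0 y by case.
apply: (@functional_of_hyperplane K V A0 y) => // [k x x' Ax Ax'|x].
  by rewrite -[x' in X in A0 X]scale1r; exact: A0D.
have [A0x|A0x] := pselect (A0 x); first by exists 0; rewrite scale0r subr0.
pose A1 := [set z | exists2 a, A0 a & exists k, z = a + k *: x]%classic.
have A0A1 a : A0 a -> A1 a.
  by exists a => //; exists 0; rewrite scale0r addr0.
have AA1 : (A `<` A1)%classic.
  split=> [a Aa|A1A]; first by apply: A0A1; left.
  apply: A0x; left; apply: A1A; exists 0; first by right.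
  by exists 1; rewrite scale1r add0r.
have [[a A0a [k yE]]|A1y] := pselect (A1 y); last first.
  case: (Amax _ AA1); split=> // k l _ _ [a Aa [m ->]] [b Ab [n ->]].
  exists (k *: a + l *: b); first exact: A0D.
  exists (k * m + l * n).
  by rewrite !scalerDr !scalerA addrACA scalerDl.
have [k0|k0] := eqVneq k 0.
  by case: A0y; rewrite yE k0 scale0r addr0.
exists k^-1; rewrite yE scalerDr scalerA mulVf // scale1r opprD addrCA subrr.
by rewrite addr0 -scaleNr -[_ *: a]addr0 -(scale0r a); exact: A0D.
Qed.

Definition finite_rank (K : fieldType) (V : lmodType K)
  (P : seq (V * {scalar V})) (x : V) : V := \sum_(p <- P) p.2 x *: p.1.

(** A finite-rank operator P fixing a sequence is corrected so as to fix y too,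
by adding mu(x) (y - P y), where mu = lam (id - P) vanishes on all fixed points
of P and lam (y - P y) = 1. *)
Lemma finite_rank_fix (K : fieldType) (V : lmodType K) (s : seq V) :
  exists P : seq (V * {scalar V}), forall x, x \in s -> finite_rank P x = x.
Proof.
elim: s => [|y s [P PE]]; first by exists [::].
have [Py|] := eqVneq y (finite_rank P y).
  by exists P => x; rewrite inE => /predU1P[->|]; [rewrite -Py|exact: PE].
rewrite -subr_eq0 => /eqP /functional_eq1[lam lam1].
have lin : scalar (fun x => lam (x - finite_rank P x)).
  move=> k x x'; rewrite -linearP; congr (lam _).
  rewrite scalerBr addrACA -opprD; congr (_ - _).
  rewrite /finite_rank scaler_sumr -big_split; apply: eq_bigr => p _.
  by rewrite linearP scalerDl scalerA.
pose mu : {scalar V} :=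
  HB.pack (fun x => lam (x - finite_rank P x))
    (GRing.isLinear.Build K V K _ _ lin).
exists ((y - finite_rank P y, mu) :: P) => x.
rewrite inE /finite_rank big_cons /=.
rewrite -!/(finite_rank _ _) => /predU1P[->|/PE Px].
  by rewrite lam1 scale1r subrK.
by rewrite Px subrr linear0 scale0r add0r.
Qed.

(** * Contraction of tensors by functionals *)

Section Contraction.
Variables (K : fieldType) (C E : lmodType K).
Implicit Types (lam : {scalar C}) (x : tensor C E).

(** The slice map lam (x) id. *)
Definition tcontract lam : tensor C E -> E := tlift (fun c a => lam c *: a).

Let contractP lam : bilinear_map (fun (c : C) (a : E) => lam c *: a).
Proof.
split=> [b a a'|a b b'|k a b|k a b] /=.
- by rewrite linearD scalerDl.
- by rewrite scalerDr.
- by rewrite linearZ /= scalerA.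
- by rewrite !scalerA mulrC.
Qed.

Lemma tcontractE lam c a : tcontract lam (ptens c a) = lam c *: a.
Proof. exact: tliftE. Qed.

Fact tcontract_is_linear lam : linear (tcontract lam).
Proof. exact: tlift_is_linear. Qed.

HB.instance Definition _ lam :=
  GRing.isLinear.Build K (tensor C E) E *:%R (tcontract lam)
    (tcontract_is_linear lam).

Fact ptens_is_linear (c : C) : linear (@ptens K C E c).
Proof. by move=> k x y; rewrite ptensDr ptensZr. Qed.

HB.instance Definition _ c :=
  GRing.isLinear.Build K E (tensor C E) *:%R (@ptens K C E c)
    (ptens_is_linear c).

Lemma ptens0l a : ptens (0 : C) a = 0 :> tensor C E.
Proof. by rewrite -[0 in LHS](scale0r 0) ptensZl scale0r. Qed.

Lemma ptens_suml (I : Type) (r : seq I) (F : I -> C) (a : E) :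
  ptens (\sum_(i <- r) F i) a = \sum_(i <- r) ptens (F i) a.
Proof.
elim: r => [|i r IHr]; first by rewrite !big_nil ptens0l.
by rewrite !big_cons ptensDl IHr.
Qed.

(** The additive closure of the pure tensors with factors in P and in Q. Left
factors are controlled to bound the part of C that a morphism uses, right
factors to bound the coefficients that a tensor involves. *)
Inductive tensor_within (P : C -> Prop) (Q : E -> Prop) : tensor C E -> Prop :=
| tensor_within0 : tensor_within P Q 0
| tensor_withinD c a x : P c -> Q a -> tensor_within P Q x ->
    tensor_within P Q (ptens c a + x).

Lemma tensor_within_sub (P P' : C -> Prop) (Q Q' : E -> Prop) x :
    (forall c, P c -> P' c) -> (forall a, Q a -> Q' a) ->
  tensor_within P Q x -> tensor_within P' Q' x.
Proof.
move=> PP' QQ'; elim=> [|c a {}x /PP' P'c /QQ' Q'a _ IHx].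
  exact: tensor_within0.
exact: tensor_withinD.
Qed.

Lemma tensor_within_add P Q x y :
  tensor_within P Q x -> tensor_within P Q y -> tensor_within P Q (x + y).
Proof.
move=> + Qy; elim=> [|c a {}x Pc Qa _ IHx]; first by rewrite add0r.
by rewrite -addrA; exact: tensor_withinD.
Qed.

Lemma tensor_within_scale (P : C -> Prop) (Q : E -> Prop) k x :
    (forall a, Q a -> Q (k *: a)) ->
  tensor_within P Q x -> tensor_within P Q (k *: x).
Proof.
move=> Qk; elim=> [|c a {}x Pc Qa _ IHx].
  by rewrite scaler0; exact: tensor_within0.
by rewrite scalerDr -ptensZr; apply: tensor_withinD => //; exact: Qk.
Qed.

Lemma tensor_within_ptens (P : C -> Prop) (Q : E -> Prop) c a :
  P c -> Q a -> tensor_within P Q (ptens c a).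
Proof.
move=> Pc Qa; rewrite -[ptens c a]addr0; apply: tensor_withinD => //.
exact: tensor_within0.
Qed.

Lemma tensor_within_finite x :
  exists s : seq C, tensor_within (fun c => c \in s) (fun=> True) x.
Proof.
elim/tensor_ind: x => [|c a x [s xs]].
  by exists [::]; exact: tensor_within0.
exists (c :: s); apply: tensor_withinD => //; first exact: mem_head.
by apply: tensor_within_sub xs => // c' c's; rewrite inE c's orbT.
Qed.

(** The operator P (x) id fixes a tensor whose left factors are fixed by P. *)
Lemma tensor_finite_rank (P : seq (C * {scalar C})) (Q : E -> Prop) x :
    tensor_within (fun c => finite_rank P c = c) Q x ->
  x = \sum_(p <- P) ptens p.1 (tcontract p.2 x).
Proof.
elim=> [|c a {}x Pc _ _ IHx].
  by rewrite big1 // => p _; rewrite !linear0.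
under eq_bigr do rewrite linearD /= linearD /= tcontractE ptensZr -ptensZl.
by rewrite big_split /= -IHx -ptens_suml -/(finite_rank P c) Pc.
Qed.

(** The left factors of a tensor are finitely many, so that the tensor is
recovered from its contractions through a finite-rank operator fixing them. *)
Lemma tcontract_inj x y :
  (forall lam, tcontract lam x = tcontract lam y) -> x = y.
Proof.
move=> xy; apply/subr0_eq; have [s xys] := tensor_within_finite (x - y).
have [P Ps] := finite_rank_fix s.
rewrite (tensor_finite_rank (tensor_within_sub Ps (fun _ => id) xys)).
by rewrite big1 // => p _; rewrite linearB /= xy subrr linear0.
Qed.

Lemma tcontract_within (P : C -> Prop) (Q : E -> Prop) lam x :
    Q 0 -> (forall a b, Q a -> Q b -> Q (a + b)) ->
    (forall k a, Q a -> Q (k *: a)) ->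
  tensor_within P Q x -> Q (tcontract lam x).
Proof.
move=> Q0 QD QZ; elim=> [|c a {}x Pc Qa _ IHx]; first by rewrite linear0.
by rewrite linearD /= tcontractE; apply: QD => //; exact: QZ.
Qed.

End Contraction.

Section AlgebraContraction.
Variables (K : fieldType) (C : ualgType K).
Implicit Types E F G : ualgType K.

Definition tensor_right E F (g : {ualgmorphism E -> F}) :
  {ualgmorphism tensor C E -> tensor C F} := tensor_map idfun g.

Lemma tensor_rightE E F (g : {ualgmorphism E -> F}) c a :
  tensor_right g (ptens c a) = ptens c (g a).
Proof. exact: tensor_mapE. Qed.

Lemma tcontract_right E F (g : {ualgmorphism E -> F}) (lam : {scalar C}) x :
  tcontract lam (tensor_right g x) = g (tcontract lam x).
Proof.
elim/tensor_ind: x => [|c a x IHx]; first by rewrite !linear0.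
rewrite !linearD /= IHx; congr (_ + _).
by rewrite tensor_rightE !tcontractE linearZ.
Qed.

Lemma tensor_right_comp E F G (h : {ualgmorphism F -> G})
    (g : {ualgmorphism E -> F}) :
  tensor_right (h \o g) =1 tensor_right h \o tensor_right g.
Proof.
by move=> x; apply: tcontract_inj => lam; rewrite /= !tcontract_right.
Qed.

Lemma tensor_within_mul E (Q : E -> Prop) (x y : tensor C E) :
    (forall a b, Q a -> Q b -> Q (umul a b)) ->
    tensor_within (fun=> True) Q x -> tensor_within (fun=> True) Q y ->
  tensor_within (fun=> True) Q (umul x y).
Proof.
move=> QM + Qy; elim=> [|c a {}x _ Qa _ IHx].
  by rewrite umul0l; exact: tensor_within0.
rewrite umulDl; apply: tensor_within_add => // {x IHx}.
elim: Qy => [|c' a' y' _ Qa' _ IHy].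
  by rewrite umul0r; exact: tensor_within0.
rewrite umulDr; apply: tensor_within_add => //.
by rewrite [umul _ _]tensor_mulE; apply: tensor_within_ptens => //; exact: QM.
Qed.

End AlgebraContraction.

Arguments tensor_right {K} C {E F} g.

(** * The algebra of coefficients *)

Section CoefficientTerms.
Variables (K : fieldType) (B C : ualgType K).

(** Formal expressions in the coefficients of an unspecified morphism e from B
to C (x) E: the leaf (b, lam) stands for (lam (x) id) (e b). *)
Inductive cterm : Type :=
| CLeaf of B & {scalar C}
| COne
| CAdd of cterm & cterm
| CMul of cterm & cterm
| CScale of K & cterm.

Section Evaluation.
Variables (E : ualgType K) (e : {ualgmorphism B -> tensor C E}).

Fixpoint ceval (t : cterm) : E :=
  match t with
  | CLeaf b lam => tcontract lam (e b)
  | COne => uone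
  | CAdd t u => ceval t + ceval u
  | CMul t u => umul (ceval t) (ceval u)
  | CScale k t => k *: ceval t
  end.

Definition admissible (s : seq B) (i : seq C) : Prop :=
  forall b, b \in s -> tensor_within (fun c => c \in i) (fun=> True) (e b).

End Evaluation.

Lemma ceval_comp (E F : ualgType K) (e : {ualgmorphism B -> tensor C E})
    (g : {ualgmorphism E -> F}) t :
  ceval (tensor_right C g \o e) t = g (ceval e t).
Proof.
elim: t => /= [b lam||t -> u ->|t -> u ->|k t ->].
- exact: tcontract_right.
- by rewrite umorph1.
- by rewrite linearD.
- by rewrite umorphM.
- by rewrite linearZ.
Qed.

Lemma admissible_sub (E : ualgType K) (e : {ualgmorphism B -> tensor C E}) s
    (i j : seq C) : {subset i <= j} -> admissible e s i -> admissible e s j.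
Proof. by move=> ij es b /es; apply: tensor_within_sub. Qed.

Lemma admissible_finite (E : ualgType K)
    (e : {ualgmorphism B -> tensor C E}) s :
  exists i : seq C, admissible e s i.
Proof.
elim: s => [|b s [i ei]]; first by exists [::].
have [j ej] := tensor_within_finite (e b); exists (j ++ i) => b'.
rewrite inE => /predU1P[->|/ei]; [move: ej|]; apply: tensor_within_sub => // c.
  by rewrite mem_cat => ->.
by rewrite mem_cat orbC => ->.
Qed.

End CoefficientTerms.

Arguments COne {K B C}.
Arguments CLeaf {K B C} b lam.
Arguments CScale {K B C} k t.

Section CoefficientAlgebra.
Variables (K : fieldType) (B C : ualgType K) (s : seq B) (i : seq C).
Local Notation term := (cterm B C).

(** Expressions are identified when they take the same value for all morphisms
admissible for i. This makes every algebra identity automatic, and spares the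
description of the relations from a presentation of B. *)
Definition ceq (t u : term) : Prop :=
  forall (E : ualgType K) (e : {ualgmorphism B -> tensor C E}),
    admissible e s i -> ceval e t = ceval e u.

Definition ceqb : rel {classic term} := fun t u => `[< ceq t u >].

Fact ceqb_refl : reflexive ceqb.
Proof. by move=> t; apply/asboolP. Qed.
Fact ceqb_sym : symmetric ceqb.
Proof.
by move=> t u; apply/asboolP/asboolP => tu E e es; rewrite (tu E e es).
Qed.
Fact ceqb_trans : transitive ceqb.
Proof.
move=> u t v /asboolP tu /asboolP uv; apply/asboolP => E e es.
by rewrite (tu E e es) (uv E e es).
Qed.

Canonical ceq_equiv := EquivRel ceqb ceqb_refl ceqb_sym ceqb_trans.

Definition calg := {eq_quot ceq_equiv}.
HB.instance Definition _ := EqQuotient.on calg.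
HB.instance Definition _ := Choice.on calg.

Definition cclass (t : term) : calg := \pi_calg (t : {classic term}).

Lemma cclassP t u : cclass t = cclass u <-> ceq t u.
Proof.
by split=> [/eqmodP /asboolP //|tu]; apply/eqmodP; exact/asboolP.
Qed.

Lemma calg_ind (P : calg -> Prop) : (forall t, P (cclass t)) -> forall x, P x.
Proof. by move=> Pt x; rewrite -[x]reprK; exact: Pt. Qed.

Definition crepr (x : calg) : term := repr x.

Lemma creprK x : cclass (crepr x) = x.
Proof. exact: reprK. Qed.

Lemma ceval_crepr (E : ualgType K) (e : {ualgmorphism B -> tensor C E}) t :
  admissible e s i -> ceval e (crepr (cclass t)) = ceval e t.
Proof. by move=> es; have /cclassP -> := creprK (cclass t). Qed.

Definition calg_add (x y : calg) := cclass (CAdd (crepr x) (crepr y)).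
Definition calg_mul (x y : calg) := cclass (CMul (crepr x) (crepr y)).
Definition calg_scale k (x : calg) := cclass (CScale k (crepr x)).
Definition calg_zero := cclass (CScale 0 COne).
Definition calg_one := cclass COne.

Lemma calg_ext x y :
  (forall (E : ualgType K) (e : {ualgmorphism B -> tensor C E}),
    admissible e s i -> ceval e (crepr x) = ceval e (crepr y)) -> x = y.
Proof. by move=> xy; rewrite -[x]creprK -[y]creprK; apply/cclassP. Qed.

Section Ceval.
Variables (E : ualgType K) (e : {ualgmorphism B -> tensor C E}).
Hypothesis es : admissible e s i.

Lemma ceval_add x y :
  ceval e (crepr (calg_add x y)) = ceval e (crepr x) + ceval e (crepr y).
Proof. exact: ceval_crepr. Qed.

Lemma ceval_mul x y :
  ceval e (crepr (calg_mul x y)) = umul (ceval e (crepr x)) (ceval e (crepr y)).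
Proof. exact: ceval_crepr. Qed.

Lemma ceval_scale k x :
  ceval e (crepr (calg_scale k x)) = k *: ceval e (crepr x).
Proof. exact: ceval_crepr. Qed.

Lemma ceval_one : ceval e (crepr calg_one) = uone.
Proof. exact: ceval_crepr. Qed.

Lemma ceval_zero : ceval e (crepr calg_zero) = 0.
Proof. by rewrite ceval_crepr //= scale0r. Qed.

End Ceval.

Definition cevalE :=
  (ceval_add, ceval_mul, ceval_scale, ceval_one, ceval_zero).

Fact calg_addA : associative calg_add.
Proof.
by move=> *; apply: calg_ext => E e es; rewrite !cevalE // addrA. Qed.
Fact calg_addC : commutative calg_add.
Proof.
by move=> *; apply: calg_ext => E e es; rewrite !cevalE // addrC. Qed.
Fact calg_add0 : left_id calg_zero calg_add.
Proof.
by move=> *; apply: calg_ext => E e es; rewrite !cevalE // add0r. Qed.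
Fact calg_addN : left_inverse calg_zero (calg_scale (- 1)) calg_add.
Proof.
by move=> *; apply: calg_ext => E e es; rewrite !cevalE // scaleN1r addNr. Qed.

HB.instance Definition _ :=
  GRing.isZmodule.Build calg calg_addA calg_addC calg_add0 calg_addN.

Fact calg_scaleA : forall k l x,
  calg_scale k (calg_scale l x) = calg_scale (k * l) x.
Proof.
by move=> *; apply: calg_ext => E e es; rewrite !cevalE // scalerA. Qed.
Fact calg_scale1 : left_id 1 calg_scale.
Proof.
by move=> *; apply: calg_ext => E e es; rewrite !cevalE // scale1r. Qed.
Fact calg_scaleDr : right_distributive calg_scale calg_add.
Proof.
by move=> *; apply: calg_ext => E e es; rewrite !cevalE // scalerDr. Qed.
Fact calg_scaleDl : forall x,
  {morph calg_scale^~ x : k l / k + l >-> calg_add k l}.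
Proof.
by move=> x k l; apply: calg_ext => E e es; rewrite !cevalE // scalerDl. Qed.

HB.instance Definition _ := GRing.Zmodule_isLmodule.Build K calg
  calg_scaleA calg_scale1 calg_scaleDr calg_scaleDl.

Fact calg_mulA : associative calg_mul.
Proof.
by move=> *; apply: calg_ext => E e es; rewrite !cevalE // umulA. Qed.
Fact calg_mul1l : left_id calg_one calg_mul.
Proof.
by move=> *; apply: calg_ext => E e es; rewrite !cevalE // umul1r. Qed.
Fact calg_mul1r : right_id calg_one calg_mul.
Proof.
by move=> *; apply: calg_ext => E e es; rewrite !cevalE // umulr1. Qed.
Fact calg_mulDl : left_distributive calg_mul calg_add.
Proof.
by move=> *; apply: calg_ext => E e es; rewrite !cevalE // umulDl. Qed.
Fact calg_mulDr : right_distributive calg_mul calg_add.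
Proof.
by move=> *; apply: calg_ext => E e es; rewrite !cevalE // umulDr. Qed.
Fact calg_mulZl : forall k x y,
  calg_mul (calg_scale k x) y = calg_scale k (calg_mul x y).
Proof.
by move=> *; apply: calg_ext => E e es; rewrite !cevalE // umulZl. Qed.
Fact calg_mulZr : forall k x y,
  calg_mul x (calg_scale k y) = calg_scale k (calg_mul x y).
Proof.
by move=> *; apply: calg_ext => E e es; rewrite !cevalE // umulZr. Qed.

HB.instance Definition _ := Lmodule_isUalgebra.Build K calg
  calg_mulA calg_mul1l calg_mul1r calg_mulDl calg_mulDr calg_mulZl calg_mulZr.

Section Specialization.
Variables (E : ualgType K) (e : {ualgmorphism B -> tensor C E}).
Hypothesis es : admissible e s i.

(** Admissibility is an argument because evaluation at e descends to
classes only under it. *)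
Definition cspec_fun of admissible e s i := fun x : calg => ceval e (crepr x).
Local Notation spec := (cspec_fun es).

Fact cspec_linear : linear spec.
Proof.
by move=> k x y; rewrite /cspec_fun ceval_crepr //= ceval_crepr.
Qed.
Fact cspec1 : spec uone = uone.
Proof. by rewrite /cspec_fun ceval_crepr. Qed.
Fact cspecM : {morph spec : x y / umul x y}.
Proof. by move=> x y; rewrite /cspec_fun ceval_crepr. Qed.

HB.instance Definition _ :=
  GRing.isLinear.Build K calg E *:%R spec cspec_linear.
HB.instance Definition _ :=
  isUmultiplicative.Build K calg E spec cspec1 cspecM.

Definition cspec : {ualgmorphism calg -> E} := spec.

Lemma cspecE t : cspec (cclass t) = ceval e t.
Proof. exact: ceval_crepr. Qed.

End Specialization.

Lemma cspec_inj (x y : calg) :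
  (forall (E : ualgType K) (e : {ualgmorphism B -> tensor C E})
     (es : admissible e s i), cspec es x = cspec es y) -> x = y.
Proof. exact: calg_ext. Qed.

(** Contractions commute with id (x) ev_e and separate tensors, so that the
joint injectivity of the ev_e passes to C (x) A_i. *)
Lemma tensor_cspec_inj (x y : tensor C calg) :
  (forall (E : ualgType K) (e : {ualgmorphism B -> tensor C E})
     (es : admissible e s i),
     tensor_right C (cspec es) x = tensor_right C (cspec es) y) -> x = y.
Proof.
move=> xy; apply: tcontract_inj => lam; apply: cspec_inj => E e es.
by rewrite -!tcontract_right xy.
Qed.

Lemma calg_term_ind (S : calg -> Prop) :
    (forall b lam, S (cclass (CLeaf b lam))) ->
    S uone ->
    (forall x y, S x -> S y -> S (x + y)) ->
    (forall x y, S x -> S y -> S (umul x y)) ->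
    (forall (k : K) x, S x -> S (k *: x)) ->
    forall x, S x.
Proof.
move=> SL S1 SD SM SZ; elim/calg_ind; elim=> [//|//|t St u Su|t St u Su|k t St].
- suff -> : cclass (CAdd t u) = cclass t + cclass u by exact: SD.
  by apply: cspec_inj => E e es; rewrite linearD /= !cspecE.
- suff -> : cclass (CMul t u) = umul (cclass t) (cclass u) by exact: SM.
  by apply: cspec_inj => E e es; rewrite umorphM /= !cspecE.
- suff -> : cclass (CScale k t) = k *: cclass t by exact: SZ.
  by apply: cspec_inj => E e es; rewrite linearZ /= !cspecE.
Qed.

End CoefficientAlgebra.

(** * The universal morphism *)

Section CoefficientRestriction.
Variables (K : fieldType) (B C : ualgType K) (s : seq B) (i j : seq C).

(** The identity on expressions: a morphism admissible for i is admissible for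
j, so that fewer relations are imposed in the source. *)
Definition crestrict_fun of {subset i <= j} :=
  fun x : calg s j => cclass s i (crepr x).

Hypothesis ij : {subset i <= j}.
Local Notation res := (crestrict_fun ij).

Lemma cspec_restrict (E : ualgType K) (e : {ualgmorphism B -> tensor C E})
    (ei : admissible e s i) (ej : admissible e s j) x :
  cspec ei (res x) = cspec ej x.
Proof. exact: cspecE. Qed.

Fact crestrict_linear : linear res.
Proof.
move=> k x y; apply: cspec_inj => E e es.
have es' := admissible_sub ij es.
by rewrite linearD linearZ /= !(cspec_restrict es es') linearD linearZ.
Qed.
Fact crestrict1 : res uone = uone.
Proof.
apply: cspec_inj => E e es.
by rewrite (cspec_restrict es (admissible_sub ij es)) !umorph1.
Qed.
Fact crestrictM : {morph res : x y / umul x y}.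
Proof.
move=> x y; apply: cspec_inj => E e es.
have es' := admissible_sub ij es.
by rewrite umorphM /= !(cspec_restrict es es') umorphM.
Qed.

HB.instance Definition _ :=
  GRing.isLinear.Build K (calg s j) (calg s i) *:%R res crestrict_linear.
HB.instance Definition _ :=
  isUmultiplicative.Build K (calg s j) (calg s i) res crestrict1 crestrictM.

Definition crestrict : {ualgmorphism calg s j -> calg s i} := res.

Lemma crestrictE t : crestrict (cclass s j t) = cclass s i t.
Proof.
apply: cspec_inj => E e es.
by rewrite (cspec_restrict es (admissible_sub ij es)) !cspecE.
Qed.

End CoefficientRestriction.

Definition generates (K : fieldType) (A : ualgType K) (s : seq A) : Prop :=
  forall S : A -> Prop,
    (forall x, x \in s -> S x) ->
    S uone ->
    (forall x y, S x -> S y -> S (x + y)) ->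
    (forall x y, S x -> S y -> S (umul x y)) ->
    (forall (k : K) x, S x -> S (k *: x)) ->
    forall x, S x.

Section UniversalCoefficients.
Variables (K : fieldType) (B C : ualgType K) (s : seq B).
Hypothesis sgen : generates s.

(** The image of b under the universal morphism, with control on its
coefficients: they lie in every subalgebra S containing the leaves (b', lam)
with b' in s and lam among the functionals of a finite-rank operator fixing i.
Taking everything for S gives the universal morphism; taking the subalgebra
generated by those leaves gives finite generation. *)
Lemma universal_element (i : seq C) (P : seq (C * {scalar C}))
    (S : calg s i -> Prop) :
    (forall c, c \in i -> finite_rank P c = c) ->
    (forall b k, b \in s -> S (cclass s i (CLeaf b (tnth (in_tuple P) k).2))) ->
    S uone ->
    (forall x y, S x -> S y -> S (x + y)) ->
    (forall x y, S x -> S y -> S (umul x y)) ->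
    (forall (k : K) x, S x -> S (k *: x)) ->
  forall b, exists2 x : tensor C (calg s i),
    tensor_within (fun=> True) S x &
    forall (E : ualgType K) (e : {ualgmorphism B -> tensor C E})
      (es : admissible e s i), tensor_right C (cspec es) x = e b.
Proof.
move=> Pi SP S1 SD SM SZ.
elim/sgen => [b bs||b b' [x xS xE] [x' xS' xE']|b b' [x xS xE] [x' xS' xE']|
  k b [x xS xE]].
- exists (\sum_(p <- P) ptens p.1 (cclass s i (CLeaf b p.2))).
    rewrite big_tnth; elim/big_ind: _ => [||k _]; first exact: tensor_within0.
      by move=> x y; exact: tensor_within_add.
    by apply: tensor_within_ptens => //; exact: SP.
  move=> E e es; rewrite linear_sum /=.
  under eq_bigr do rewrite tensor_rightE cspecE /=.
  apply/esym/tensor_finite_rank.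
  exact: tensor_within_sub Pi (fun _ => id) (es b bs).
- exists uone; first exact: tensor_within_ptens.
  by move=> E e es; rewrite !umorph1.
- exists (x + x'); first exact: tensor_within_add.
  by move=> E e es; rewrite !linearD /= xE xE'.
- exists (umul x x'); first exact: tensor_within_mul.
  by move=> E e es; rewrite !umorphM /= xE xE'.
- exists (k *: x); first by apply: tensor_within_scale => //; exact: SZ.
  by move=> E e es; rewrite !linearZ /= xE.
Qed.

Section Coaction.
Variable i : seq C.

Lemma coact_exists b : exists x : tensor C (calg s i),
  forall (E : ualgType K) (e : {ualgmorphism B -> tensor C E})
    (es : admissible e s i), tensor_right C (cspec es) x = e b.
Proof.
have [P Pi] := finite_rank_fix i.
have [||||||x _ xE] // := @universal_element i P (fun=> True) _ _ _ _ _ _ b.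
by exists x.
Qed.

Definition coact_fun b : tensor C (calg s i) := sval (cid (coact_exists b)).

Lemma coact_funE b (E : ualgType K) (e : {ualgmorphism B -> tensor C E})
  (es : admissible e s i) : tensor_right C (cspec es) (coact_fun b) = e b.
Proof. by rewrite /coact_fun; case: cid. Qed.

Fact coact_linear : linear coact_fun.
Proof.
move=> k x y; apply: tensor_cspec_inj => E e es.
by rewrite linearD linearZ /= !coact_funE linearD linearZ.
Qed.
Fact coact1 : coact_fun uone = uone.
Proof.
by apply: tensor_cspec_inj => E e es; rewrite coact_funE !umorph1.
Qed.
Fact coactM : {morph coact_fun : x y / umul x y}.
Proof.
move=> x y; apply: tensor_cspec_inj => E e es.
by rewrite umorphM /= !coact_funE umorphM.
Qed.

HB.instance Definition _ :=
  GRing.isLinear.Build K B (tensor C (calg s i)) *:%R coact_fun coact_linear.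
HB.instance Definition _ :=
  isUmultiplicative.Build K B (tensor C (calg s i)) coact_fun coact1 coactM.

Definition coact : {ualgmorphism B -> tensor C (calg s i)} := coact_fun.

Lemma coactE b (E : ualgType K) (e : {ualgmorphism B -> tensor C E})
  (es : admissible e s i) : tensor_right C (cspec es) (coact b) = e b.
Proof. exact: coact_funE. Qed.

(** The universal morphism has the symbols (b, lam) as coefficients; this makes
morphisms out of A_i determined by their effect on it. *)
Lemma tcontract_coact b (lam : {scalar C}) :
  tcontract lam (coact b) = cclass s i (CLeaf b lam).
Proof.
apply: cspec_inj => E e es.
by rewrite -tcontract_right coactE cspecE.
Qed.

Lemma ceval_coact t : ceval coact t = cclass s i t.
Proof.
apply: cspec_inj => E e es; rewrite -ceval_comp cspecE.
by congr ceval; apply: ualgmorphismP => b; exact: coactE.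
Qed.

(** Every symbol (b, lam) is a contraction of the image of b, whose
coefficients can be found in the subalgebra generated by the leaves on s and
on the functionals of a fixed finite-rank operator. *)
Lemma finitely_generated_calg : finitely_generated (calg s i : ualgType K).
Proof.
have [P Pi] := finite_rank_fix i.
exists [seq cclass s i (CLeaf b (tnth (in_tuple P) k).2) |
  b <- s, k <- enum 'I_(size P)] => S Sgen S1 SD SM SZ.
apply: calg_term_ind => // b lam.
have [b' k bs|x xS xE] := @universal_element i P S Pi _ S1 SD SM SZ b.
  apply: Sgen; apply/allpairsP; exists (b', k).
  by split=> //=; rewrite mem_enum.
have -> : cclass s i (CLeaf b lam) = tcontract lam x.
  apply: cspec_inj => E e es.
  by rewrite cspecE /= -tcontract_right xE.
apply: tcontract_within xS => //.
by rewrite -(scale0r uone); exact: SZ.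
Qed.

End Coaction.

Lemma coact_restrict (i j : seq C) (ij : {subset i <= j}) b :
  tensor_right C (crestrict s ij) (coact j b) = coact i b.
Proof.
apply: tcontract_inj => lam.
by rewrite tcontract_right !tcontract_coact crestrictE.
Qed.

(** Evaluation commutes with g, and at h_i it sends an expression to its own
class; hence g can be read off from (id (x) g) h_i. *)
Lemma calg_morphismE (i : seq C) (E : ualgType K)
    (g : {ualgmorphism calg s i -> E}) t :
  g (cclass s i t) = ceval (tensor_right C g \o coact i) t.
Proof. by rewrite ceval_comp ceval_coact. Qed.

End UniversalCoefficients.

(** * The universal pro-algebra *)

Section ConstantPro.
Variables (C : category) (a : C).

Lemma const_germ_inj (d : C) (f g : mor a d) :
  @mkgerm C (pro_const_ob a) d tt f = @mkgerm C (pro_const_ob a) d tt g ->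
  f = g.
Proof.
by move=> /mkgermP[k [h [h' /=]]]; rewrite !compm1.
Qed.

Lemma const_germK (d : C) (u : germ (pro_const_ob a) d) :
  @mkgerm C (pro_const_ob a) d tt (germ_map u) = u.
Proof.
by rewrite -[RHS]germK; case: (germ_idx u).
Qed.

End ConstantPro.

Program Definition subset_dset (T : eqType) : directed_set :=
  @DirectedSet (seq T) (fun i j => {subset i <= j}) _ _ (inhabits [::]) _.
Next Obligation. by move=> T i x. Qed.
Next Obligation. by move=> T i j k ij jk x /ij; exact: jk. Qed.
Next Obligation.
move=> T i j; exists (i ++ j).
by split=> x xi; rewrite mem_cat xi ?orbT.
Qed.

Section UniversalProAlgebra.
Variables (K : fieldType) (B : fgalg_cat K) (C : alg_cat K).
Variable s : seq (sval B : ualgType K).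
Hypothesis sgen : generates s.

Definition calg_fg (i : seq (C : ualgType K)) : fgalg_cat K :=
  exist _ (calg s i : ualgType K) (finitely_generated_calg sgen i).

Program Definition pro_calg : pro_cat (fgalg_cat K) :=
  @ProObject (fgalg_cat K) (subset_dset (C : ualgType K)) calg_fg
    (fun i j h => crestrict s h) _ _.
Next Obligation.
move=> i h; apply: ualgmorphismP; elim/calg_ind => t.
by rewrite crestrictE.
Qed.
Next Obligation.
move=> i j k h h' h''; apply: ualgmorphismP; elim/calg_ind => t.
by rewrite /= [LHS]crestrictE [crestrict_fun h' _]crestrictE [RHS]crestrictE.
Qed.

Program Definition pro_coact :
    mor (fgalgP B) (algP C \ox profg_incl pro_calg) :=
  @ProMor (alg_cat K) (fgalgP B) (algP C \ox profg_incl pro_calg)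
    (fun p => @mkgerm (alg_cat K) (fgalgP B) _ tt (coact sgen p.2)) _.
Next Obligation.
move=> [[] i] [[] j] [h ij]; rewrite germ_postE; congr mkgerm.
by apply: ualgmorphismP => b; exact: coact_restrict.
Qed.

Variable E : pro_cat (alg_cat K).

Lemma id_tensor_germ (X : pro_cat (alg_cat K)) (phi : mor X E) j i
    (g : mor (X i) (E j)) :
    phi j = mkgerm g ->
  (idm (algP C) \oxm phi) (tt, j) =
    @mkgerm (alg_cat K) (algP C \ox X) (tensor C (E j) : ualgType K) (tt, i)
      (tensor_right C g).
Proof.
move=> phij; rewrite /= phij.
by rewrite [germ_pair _ _]germ_pairE [LHS]germ_fmapE.
Qed.

Lemma comp_pro_coact (phi : mor (profg_incl pro_calg) E) (i : seq C) j
    (g : {ualgmorphism calg s i -> E j}) :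
    phi j = @mkgerm (alg_cat K) (profg_incl pro_calg) (E j) i g ->
  ((idm (algP C) \oxm phi) \oc pro_coact) (tt, j) =
    @mkgerm (alg_cat K) (fgalgP B) (tensor C (E j) : ualgType K) tt
      (tensor_right C g \o coact sgen i).
Proof.
move=> /id_tensor_germ phij.
by rewrite [LHS]/= -/(pgerm _ _) [X in germ_pre _ X]phij germ_preE germ_postE.
Qed.

(** Uniqueness of factorizations in the colimit: over an index containing both
i and i', the two morphisms are the evaluation at the same morphism. *)
Lemma pro_calg_germ_eq (F : alg_cat K) (i i' : seq C)
    (g : {ualgmorphism calg s i -> F}) (g' : {ualgmorphism calg s i' -> F}) :
    tensor_right C g \o coact sgen i =1 tensor_right C g' \o coact sgen i' ->
  @mkgerm (alg_cat K) (profg_incl pro_calg) F i g =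
  @mkgerm (alg_cat K) (profg_incl pro_calg) F i' g'.
Proof.
move=> gg'; apply/mkgermP.
have [k [ik i'k]] := @dle_directed (subset_dset C) i i'.
exists k, ik, i'k; apply: ualgmorphismP; elim/calg_ind => t /=.
rewrite (crestrictE s ik) (crestrictE s i'k) !(calg_morphismE sgen).
by congr ceval; exact: ualgmorphismP.
Qed.

Lemma pro_coact_universal (e : mor (fgalgP B) (algP C \ox E)) :
  exists! ehat : mor (profg_incl pro_calg) E,
    e = (idm (algP C) \oxm ehat) \oc pro_coact.
Proof.
pose ej (j : pidx E) : {ualgmorphism sval B -> tensor C (E j)} :=
  germ_map (e (tt, j)).
have ejE j : e (tt, j) = @mkgerm (alg_cat K) (fgalgP B) _ tt (ej j).
  exact/esym/const_germK.
have factor j : {ig : {i : seq C & {ualgmorphism calg s i -> E j}} |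
    tensor_right C (tagged ig) \o coact sgen (tag ig) =1 ej j}.
  apply: cid; have [i es] := admissible_finite (ej j) s.
  exists (Tagged (fun i => {ualgmorphism calg s i -> E j}) (cspec es)) => b.
  exact: coactE.
pose idx j := tag (sval (factor j)).
pose g j : {ualgmorphism calg s (idx j) -> E j} := tagged (sval (factor j)).
have gE j : tensor_right C (g j) \o coact sgen (idx j) =1 ej j.
  exact: svalP (factor j).
pose ehat_fun j :=
  @mkgerm (alg_cat K) (profg_incl pro_calg) (E j) (idx j) (g j).
have ehat_compat j j' (h : dle j j') :
    germ_post (ptr E h) (ehat_fun j') = ehat_fun j.
  rewrite germ_postE; apply: pro_calg_germ_eq => b; rewrite gE.
  have ej_compat :
      (tensor_right C (ptr E h) : mor (_ : alg_cat K) _) \oc ej j' = ej j.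
    apply: const_germ_inj.
    (* The transition map of C (x) E is indexed by a projection of a proof of a
       conjunction, and this projection is opaque. *)
    rewrite (Prop_irrelevance h (proj2 (conj I h))).
    have := @pgerm_compat _ _ _ e (tt, j) (tt, j') (conj I h).
    rewrite !ejE germ_postE; exact: id.
  rewrite -ej_compat /= -gE; exact: tensor_right_comp.
exists (@ProMor (alg_cat K) (profg_incl pro_calg) E ehat_fun ehat_compat).
split=> [|phi ephi].
  apply: pro_morP => -[[] j].
  rewrite ejE (@comp_pro_coact _ (idx j) _ (g j)) //.
  by congr mkgerm; apply: ualgmorphismP => b; rewrite /= -gE.
apply: pro_morP => j /=; have phij := esym (germK (phi j)).
rewrite [RHS]phij.
apply: pro_calg_germ_eq => b; rewrite gE.
have := ejE j; rewrite {1}ephi (comp_pro_coact phij) => /const_germ_inj <-.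
exact: erefl.
Qed.

End UniversalProAlgebra.

(** * Functoriality *)

Section SubcategoryPro.
Variables (C : category) (P : C -> Prop).
Local Notation incl := (pro_functor (subcat_incl P)).
Variables X Y : pro_cat (full_subcat P).

Lemma pro_incl_faithful (phi psi : mor X Y) :
  fmap incl phi = fmap incl psi -> phi = psi.
Proof.
move=> /(congr1 (@pgerm _ _ _)) pp; apply: pro_morP => j.
have := congr1 (fun f => f j) pp; rewrite /=.
elim/germ_ind: (phi j) => i f; elim/germ_ind: (psi j) => i' f'.
rewrite !germ_fmapE => /mkgermP[k [h [h' ff']]].
by apply/mkgermP; exists k, h, h'.
Qed.

(** The germs of a pro-morphism between pro-objects of a full subcategory
already consist of morphisms of this subcategory. *)
Lemma pro_incl_full (phi : mor (incl X) (incl Y)) :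
  exists psi : mor X Y, fmap incl psi = phi.
Proof.
pose psi j : germ (X : pro_object (full_subcat P)) (Y j) :=
  @mkgerm (full_subcat P) X (Y j) (germ_idx (phi j)) (germ_map (phi j)).
have psi_compat j j' (h : dle j j') : germ_post (ptr Y h) (psi j') = psi j.
  rewrite germ_postE; apply/mkgermP.
  have := @pgerm_compat _ _ _ phi j j' h.
  rewrite -[in LHS](germK (phi j')) -[in RHS](germK (phi j)) germ_postE.
  by move=> /mkgermP[k [m [m' e]]]; exists k, m, m'.
exists (ProMor psi_compat); apply: pro_morP => j /=.
by rewrite germ_fmapE; exact: germK.
Qed.

End SubcategoryPro.

Section TensorBifunctor.
Variable K : fieldType.
Implicit Types X Y Z : pro_cat (alg_cat K).

Lemma oxm1 X Y : idm X \oxm idm Y = idm (X \ox Y).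
Proof. exact: (fmap1 (pro_tensor K) (X, Y)). Qed.

Lemma oxmM X X' X'' Y Y' Y'' (f' : mor X' X'') (f : mor X X')
    (g' : mor Y' Y'') (g : mor Y Y') :
  (f' \oc f) \oxm (g' \oc g) = (f' \oxm g') \oc (f \oxm g).
Proof.
exact: (fmapM (pro_tensor K) (a := (X, Y)) (b := (X', Y')) (c := (X'', Y''))
  (f', g') (f, g)).
Qed.

Lemma oxm_interchange X X' Y Y' (f : mor X X') (g : mor Y Y') :
  (idm X' \oxm g) \oc (f \oxm idm Y) = (f \oxm idm Y') \oc (idm X \oxm g).
Proof. by rewrite -!oxmM !comp1m !compm1. Qed.

End TensorBifunctor.

Section FunctorOfUniversalArrows.
Variables (K : fieldType)
  (X : fgalg_cat K -> alg_cat K -> pro_cat (fgalg_cat K))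
  (h : forall B C, mor (fgalgP B) (algP C \ox profg_incl (X B C))).
Hypothesis univ : forall B C (E : pro_cat (alg_cat K))
  (e : mor (fgalgP B) (algP C \ox E)),
  exists! ehat : mor (profg_incl (X B C)) E,
    e = (idm (algP C) \oxm ehat) \oc h B C.

(** Uniqueness of factorizations through h, as a cancellation property. *)
Lemma univ_inj B C E (phi psi : mor (profg_incl (X B C)) E) :
  (idm (algP C) \oxm phi) \oc h B C = (idm (algP C) \oxm psi) \oc h B C ->
  phi = psi.
Proof.
move=> pp; have [chi [_ chiU]] := univ ((idm (algP C) \oxm phi) \oc h B C).
by rewrite -(chiU phi erefl) -(chiU psi pp).
Qed.

Section Action.
Variables (B B' : fgalg_cat K) (C C' : alg_cat K).
Variables (g : mor B B') (f : mor C' C).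

(** Naturality of h, read as an equation for the morphism induced by (g, f). *)
Definition is_transport (psi : mor (X B C) (X B' C')) : Prop :=
  (idm (algP C) \oxm fmap profg_incl psi) \oc h B C =
  (fmap algP f \oxm idm (profg_incl (X B' C'))) \oc h B' C' \oc fmap fgalgP g.

Lemma transport_exists : exists psi, is_transport psi.
Proof.
have [phi [phiE _]] := univ ((fmap algP f \oxm idm (profg_incl (X B' C')))
  \oc h B' C' \oc fmap fgalgP g).
by have [psi psiE] := pro_incl_full phi; exists psi; rewrite /is_transport psiE.
Qed.

Lemma transport_unique psi psi' :
  is_transport psi -> is_transport psi' -> psi = psi'.
Proof.
by move=> a a'; apply/pro_incl_faithful/univ_inj; rewrite a.
Qed.

Definition transport := sval (cid transport_exists).

Lemma transportP : is_transport transport.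
Proof. exact: svalP (cid transport_exists). Qed.

End Action.

Lemma transport1 B C : transport (idm B) (idm C) = idm (X B C).
Proof.
apply: transport_unique (transportP _ _) _.
by rewrite /is_transport !fmap1 !oxm1 compm1.
Qed.

Lemma transportM B B' B'' C C' C'' (g' : mor B' B'') (g : mor B B')
    (f' : mor C'' C') (f : mor C' C) :
  transport (g' \oc g) (f \oc f') = transport g' f' \oc transport g f.
Proof.
apply: transport_unique (transportP _ _) _; rewrite /is_transport !fmapM.
rewrite -[idm (algP C)]comp1m oxmM -compmA transportP.
rewrite !compmA oxm_interchange -[in LHS](compmA _ (idm _ \oxm _)) transportP.
by rewrite !compmA -oxmM comp1m.
Qed.

Definition transport_functor :
    functor (prod_cat (fgalg_cat K) (op_cat (alg_cat K)))
            (pro_cat (fgalg_cat K)) :=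
  @Functor (prod_cat (fgalg_cat K) (op_cat (alg_cat K)))
    (pro_cat (fgalg_cat K)) (fun p => X p.1 p.2)
    (fun _ _ u => transport u.1 u.2)
    (fun a => transport1 a.1 a.2)
    (fun _ _ _ u v => transportM u.1 v.1 u.2 v.2).

End FunctorOfUniversalArrows.

Theorem theorem2p6 (K : fieldType) :
  exists (fA : functor (prod_cat (fgalg_cat K) (op_cat (alg_cat K)))
                       (pro_cat (fgalg_cat K)))
         (h : forall (B : fgalg_cat K) (C : alg_cat K),
            mor (fgalgP B) (algP C \ox profg_incl (fA (B, C)))),
    (forall (B B' : fgalg_cat K) (C C' : alg_cat K)
            (g : mor B B') (f : mor C' C),
       (idm (algP C) \oxm
          fmap profg_incl (fmap fA (a := (B, C)) (b := (B', C')) (g, f)))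
         \oc h B C
       = (fmap algP f \oxm idm (profg_incl (fA (B', C'))))
         \oc h B' C' \oc fmap fgalgP g) /\
    (forall (B : fgalg_cat K) (C : alg_cat K) (E : pro_cat (alg_cat K))
            (e : mor (fgalgP B) (algP C \ox E)),
       exists! ehat : mor (profg_incl (fA (B, C))) E,
         e = (idm (algP C) \oxm ehat) \oc h B C).
Proof.
pose s (B : fgalg_cat K) := cid (svalP B).
pose X B C := pro_calg C (svalP (s B)).
pose h B C := pro_coact C (svalP (s B)).
have univ B C (E : pro_cat (alg_cat K)) (e : mor (fgalgP B) (algP C \ox E)) :
    exists! ehat : mor (profg_incl (X B C)) E,
      e = (idm (algP C) \oxm ehat) \oc h B C.
  exact: pro_coact_universal.
exists (transport_functor univ), h; split=> [B B' C C' g f|B C E e].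
  exact: transportP.
exact: univ.
Qed.
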